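(* Let $M\in\mathbb{R}^{n\times n}$, $q\in\mathbb{R}^n$, $r\ge 2$, and let $f_r$, $\mathrm{sol}(M,q)$, $\mathrm{fea}(M,q)$ and $\mathcal{G}_f$ be as in the context. Then: 1) If $M$ is positive semidefinite and $\mathrm{fea}(M,q)$ is nonempty, then $\mathrm{sol}(M,q)=\mathcal{G}_f$ and this set is nonempty. 2) If $M$ is a P-matrix, then $\mathrm{sol}(M,q)=\mathcal{G}_f=\{x^*\}$, where $x^*$ is the unique element of $\mathrm{sol}(M,q)$.
   Context: $f_r(x)=\frac1r\big[\langle x_+^r,(Mx+q)_+^r\rangle+\|x_-\|_r^r+\|(Mx+q)_-\|_r^r\big]$, where $a_+=\max\{a,0\}$, $a_-=\min\{a,0\}$ componentwise, $x_+^r$ is the componentwise $r$th power of $x_+$, and $\|z\|_r^r=\sum_i|z_i|^r$ (this function is continuously differentiable for $r\ge 2$). $\mathrm{sol}(M,q)=\{x\in\mathbb{R}^n: x\ge0,\ Mx+q\ge0,\ \langle x,Mx+q\rangle=0\}$; $\mathrm{fea}(M,q)=\{x\in\mathbb{R}^n: x\ge0,\ Mx+q\ge0\}$; $\mathcal{G}_f=\{x\in\mathbb{R}^n:\nabla f_r(x)=0\}$. A P-matrix is a square matrix all of whose principal minors are positive. *)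

(* Defs.v *)
From HB Require Import structures.
From mathcomp Require Import all_boot all_order all_algebra.
From mathcomp Require Import all_classical all_reals all_analysis.
Set Implicit Arguments. Unset Strict Implicit. Unset Printing Implicit Defensive.
Import Order.TTheory GRing.Theory Num.Theory.
Import numFieldNormedType.Exports.
Local Open Scope ring_scope.
Local Open Scope classical_set_scope.

Section LCP.
Variables (R : realType) (n : nat).

Definition pospart (a : R) : R := Num.max a 0.
Definition negpart (a : R) : R := Num.min a 0.

Definition f_r (M : 'M[R]_n) (q : 'cV[R]_n) (r : R) (x : 'cV[R]_n) : R :=
  let w := M *m x + q in
  r^-1 * (\sum_(i < n) (pospart (x i 0) `^ r) * (pospart (w i 0) `^ r)
        + \sum_(i < n) `|negpart (x i 0)| `^ r
        + \sum_(i < n) `|negpart (w i 0)| `^ r).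

Definition grad (f : 'cV[R]_n -> R) (x : 'cV[R]_n) : 'cV[R]_n :=
  \col_(i < n) ('D_(delta_mx i 0 : 'cV[R]_n) f x).

Definition sol (M : 'M[R]_n) (q : 'cV[R]_n) : set 'cV[R]_n :=
  fun x => (forall i, 0 <= x i 0) /\ (forall i, 0 <= (M *m x + q) i 0)
           /\ (x^T *m (M *m x + q)) 0 0 = 0.

Definition fea (M : 'M[R]_n) (q : 'cV[R]_n) : set 'cV[R]_n :=
  fun x => (forall i, 0 <= x i 0) /\ (forall i, 0 <= (M *m x + q) i 0).

Definition Gf (M : 'M[R]_n) (q : 'cV[R]_n) (r : R) : set 'cV[R]_n :=
  fun x => grad (f_r M q r) x = 0.

(* positive semidefinite (not necessarily symmetric): x^T M x >= 0 *)
Definition psd (M : 'M[R]_n) : Prop := forall x : 'cV[R]_n, 0 <= (x^T *m M *m x) 0 0.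

Definition Pmatrix (M : 'M[R]_n) : Prop :=
  forall S : {set 'I_n}, S != finset.set0 ->
    0 < \det (mxsub (@enum_val _ (mem S)) (@enum_val _ (mem S)) M).

End LCP.

(* Main.v *)
Require Import Defs.
From HB Require Import structures.
From mathcomp Require Import all_boot all_order all_algebra.
From mathcomp Require Import all_classical all_reals all_analysis.
From mathcomp Require Import perm ring lra.
Import Order.TTheory GRing.Theory Num.Theory.
Import numFieldNormedType.Exports.
Set Implicit Arguments. Unset Strict Implicit. Unset Printing Implicit Defensive.
Local Open Scope ring_scope.
Local Open Scope classical_set_scope.

(** With [w = M x + q], the gradient of [f_r] at [x] is [u + M^T v], where [u_i]
    and [v_i] depend only on [(x_i, w_i)], satisfy [u_i v_i >= 0], and vanish
    simultaneously for all [i] exactly at solutions.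

    At a stationary point [v_i (M^T v)_i = - u_i v_i <= 0].  A P-matrix reverses
    the sign of no nonzero vector, so [v = 0], hence [u = 0].  If [M] is positive
    semidefinite, all [u_i v_i] vanish, and pairing [u + M^T v = 0] with [x] and
    with a feasible point gives [sum |x_-|^r + sum |w_-|^r <= 0].

    Existence: if neither [M] nor [M^T] reverses signs, [f_r] is continuous with
    bounded sublevel sets, so it has a minimizer, which is stationary.  In the
    positive semidefinite case apply this to [M + e I]; the solution [x_e]
    satisfies [e |x_e|^2 <= K] by monotonicity against a feasible point.  If no
    complementary cone contained [q], Farkas' lemma would separate [q] from each
    of these finitely many cones, while [q + e x_e] lies in one of them and
    [e x_e] tends to [0]. *)

(** * Principal minors and sign reversal *)

(** Indexing by injections instead of subsets makes the property pass to principal submatrices by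
    plain composition. *)
Definition pminors_pos (R : realType) n (M : 'M[R]_n) :=
  forall m (f : 'I_m -> 'I_n), injective f -> 0 < \det (mxsub f f M).

(** The Fiedler-Ptak criterion for P-matrices. It also holds for [M + e%:M] with [M] positive
    semidefinite and [e > 0], so both halves of the theorem meet here. *)
Definition no_sign_reversal (R : realType) n (M : 'M[R]_n) :=
  forall x : 'cV[R]_n, (forall i, x i 0 * (M *m x) i 0 <= 0) -> x = 0.

Section PrincipalMinors.
Variable R : realType.

(** An injection between ordinals of equal size is a permutation; it acts on rows and on columns, so
    its sign occurs twice. The equality [m = k] is propositional because [k] will be the cardinal of
    an image. *)
Lemma det_mxsub_comp m k n (M : 'M[R]_n) (g : 'I_k -> 'I_n) (h : 'I_m -> 'I_k) :
  m = k -> injective h -> \det (mxsub (g \o h) (g \o h) M) = \det (mxsub g g M).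
Proof.
move=> e; subst k => inj_h.
have -> : mxsub (g \o h) (g \o h) M =
    row_perm (perm inj_h) (col_perm (perm inj_h) (mxsub g g M)).
  by apply/matrixP => i j; rewrite !mxE !permE.
rewrite row_permE col_permE !det_mulmx !det_perm mulrC -mulrA -signr_addb.
by rewrite odd_permV addbb mulr1.
Qed.

Lemma Pmatrix_pminors_pos n (M : 'M[R]_n) : Pmatrix M -> pminors_pos M.
Proof.
move=> PM m f inj_f.
(* [Pmatrix] speaks only of nonempty index sets; the empty minor is 1. *)
case: m f inj_f => [|m] f inj_f; first by rewrite det_mx00 ltr01.
pose S := [set f i | i in 'I_m.+1]%SET.
have fS i : f i \in S by apply: imset_f.
have cS : m.+1 = #|S| by rewrite card_imset // card_ord.
pose h i := enum_rank_in (fS ord0) (f i).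
have gh : f =1 enum_val \o h.
  by move=> i /=; rewrite enum_rankK_in.
have inj_h : injective h.
  by move=> i j /(congr1 enum_val); rewrite -[LHS]gh -[RHS]gh => /inj_f.
have -> : f = enum_val \o h by apply/funext => i; exact: gh.
rewrite det_mxsub_comp //; apply: PM.
by apply/set0Pn; exists (f ord0).
Qed.

Lemma pminors_pos_mxsub n m (f : 'I_m -> 'I_n) (M : 'M[R]_n) :
  injective f -> pminors_pos M -> pminors_pos (mxsub f f M).
Proof.
move=> inj_f PM k g inj_g; rewrite -mxsub_comp.
by apply: PM; apply: inj_comp.
Qed.

Lemma pminors_pos_tr n (M : 'M[R]_n) : pminors_pos M -> pminors_pos M^T.
Proof.
move=> PM m f inj_f.
have -> : mxsub f f M^T = (mxsub f f M)^T by apply/matrixP => i j; rewrite !mxE.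
by rewrite det_tr; apply: PM.
Qed.

(** Only the [(j, j)] entry of row [j] changes, and the cofactors of that row do not see it: expand
    along row [j]. *)
Lemma det_add_delta n (A : 'M[R]_n) (j : 'I_n) (t : R) :
  \det (A + t *: delta_mx j j) =
  \det A + t * \det (mxsub (lift j) (lift j) A).
Proof.
have cof k : cofactor (A + t *: delta_mx j j) j k = cofactor A j k.
  rewrite /cofactor; congr (_ * \det _).
  apply/matrixP => a b; rewrite !mxE eq_sym (negbTE (neq_lift _ _)) /=.
  by rewrite mulr0 addr0.
rewrite (expand_det_row _ j) (expand_det_row A j).
under eq_bigr do rewrite cof !mxE eqxx /= mulrDl.
rewrite big_split /=; congr (_ + _).
rewrite (bigD1 j) //= eqxx mulr1 big1 ?addr0; last first.
  by move=> k /negbTE ->; rewrite mulr0 mul0r.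
rewrite /cofactor addnn -signr_odd odd_double mul1r; congr (_ * \det _).
by apply/matrixP => a b; rewrite !mxE.
Qed.

(** A minor whose index set misses [i] is unchanged; any other gains [t] times a smaller principal
    minor, which is positive. *)
Lemma pminors_pos_add_delta n (M : 'M[R]_n) (i : 'I_n) (t : R) :
  0 <= t -> pminors_pos M -> pminors_pos (M + t *: delta_mx i i).
Proof.
move=> t0 PM m f inj_f.
have [/existsP [j /eqP fj]|/existsPn nf] := boolP [exists j, f j == i]; last first.
  suff -> : mxsub f f (M + t *: delta_mx i i) = mxsub f f M by apply: PM.
  apply/matrixP => a b; rewrite !mxE (negbTE (nf a)) /=.
  by rewrite mulr0 addr0.
have -> : mxsub f f (M + t *: delta_mx i i) = mxsub f f M + t *: delta_mx j j.
  by apply/matrixP => a b; rewrite !mxE -fj !(inj_eq inj_f).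
rewrite det_add_delta -mxsub_comp ltr_pwDl //; first exact: PM.
apply: mulr_ge0 => //; apply: ltW; apply: PM.
by apply: inj_comp => //; apply: lift_inj.
Qed.

Lemma pminors_pos_add_diag n (M : 'M[R]_n) (d : 'rV[R]_n) :
  (forall i, 0 <= d 0 i) -> pminors_pos M -> pminors_pos (M + diag_mx d).
Proof.
move=> d0 PM; rewrite diag_mx_sum_delta.
elim/big_rec: _ => [|i x _ Px]; first by rewrite addr0.
by rewrite addrCA addrC; apply: pminors_pos_add_delta.
Qed.

(* Restricted to the support of [x], a sign reversal makes [x] a null vector of
   a principal submatrix of [M] plus a nonnegative diagonal. *)
Lemma pminors_pos_no_sign_reversal n (M : 'M[R]_n) :
  pminors_pos M -> no_sign_reversal M.
Proof.
move=> PM x xMx.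
pose S := [set i | x i 0 != 0]%SET.
pose f := @enum_val _ (mem S).
have xf i : x (f i) 0 != 0 by have := enum_valP i; rewrite inE.
pose y := rowsub f x.
(* [d] solves [(M x)_i + d_i x_i = 0] on the support; the sign reversal makes it nonnegative. *)
pose d := \row_i (- ((M *m x) (f i) 0 / x (f i) 0)).
have d0 i : 0 <= d 0 i.
  have x2 : 0 < x (f i) 0 ^+ 2 by rewrite exprn_even_gt0 //=.
  by rewrite mxE oppr_ge0 -(pmulr_lle0 _ x2) expr2 mulrA mulfVK // mulrC.
have PA : pminors_pos (mxsub f f M + diag_mx d).
  by apply: pminors_pos_add_diag => //; apply: pminors_pos_mxsub => //; apply: enum_val_inj.
have Ay : (mxsub f f M + diag_mx d) *m y = 0.
  apply/matrixP => i j; rewrite (ord1 j) mulmxDl mul_diag_mx !mxE.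
  rewrite mulNr mulfVK //; apply/eqP; rewrite subr_eq0.
  (* Entries of [x] off the support contribute nothing, so the full product reduces to the submatrix
     applied to [y]. *)
  rewrite [X in _ == X](bigID (mem S)) /=.
  rewrite [X in _ + X]big1 ?addr0; last first.
    by move=> k; rewrite inE negbK => /eqP ->; rewrite mulr0.
  by rewrite [X in _ == X]big_enum_val /=; apply/eqP; apply: eq_bigr => k _; rewrite !mxE.
have uA : mxsub f f M + diag_mx d \in unitmx.
  rewrite unitmxE unitfE; apply: lt0r_neq0.
  have -> : mxsub f f M + diag_mx d = mxsub id id (mxsub f f M + diag_mx d).
    by apply/matrixP => a b; rewrite [RHS]mxE.
  exact: PA.
have y0 : y = 0 by rewrite -(mulKmx uA y) Ay mulmx0.
apply/matrixP => i j; rewrite (ord1 j) mxE; apply/eqP/negP => /negP xi.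
have iS : i \in S by rewrite inE.
have := congr1 (fun z : 'cV_#|S| => z (enum_rank_in iS i) 0) y0.
by rewrite !mxE /f enum_rankK_in // => /eqP; apply/negP.
Qed.

End PrincipalMinors.

(** * Separation from a finitely generated cone *)

(** Induction on the number of columns. A functional [p] separating [y] from the cone of the last
    columns also serves if it is nonnegative on the first column [a]; otherwise the induction
    hypothesis is applied again after projecting [a] away. *)
Lemma farkas (R : realType) n m (A : 'M[R]_(n, m)) (y : 'cV[R]_n) :
  (exists x : 'cV[R]_m, (forall i, 0 <= x i 0) /\ A *m x = y) \/
  (exists p : 'rV[R]_n, (forall j, 0 <= (p *m A) 0 j) /\ (p *m y) 0 0 < 0).
Proof.
elim: m A y => [|m IH] A y.
  have [->|y0] := eqVneq y 0.
    by left; exists 0; split; [case|rewrite mulmx0].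
  right; exists (- y^T); split; first by case.
  have [i yi] : exists i, y i 0 != 0.
    apply/existsP; apply: contraNT y0 => /existsPn y0; apply/eqP/matrixP => i j.
    by rewrite (ord1 j) mxE; apply/eqP; rewrite -[_ == _]negbK y0.
  rewrite mulNmx mxE oppr_lt0 mxE (bigD1 i) //= ltr_pwDl //.
    by rewrite mxE -expr2 exprn_even_gt0.
  by apply: sumr_ge0 => k _; rewrite mxE -expr2 sqr_ge0.
pose a : 'cV[R]_n := lsubmx (A : 'M[R]_(n, 1 + m)).
pose A' : 'M[R]_(n, m) := rsubmx (A : 'M[R]_(n, 1 + m)).
have AE : (A : 'M[R]_(n, 1 + m)) = row_mx a A' by rewrite hsubmxK.
have col_ge0 (s : 'cV[R]_1) (x : 'cV[R]_m) : 0 <= s 0 0 ->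
    (forall i, 0 <= x i 0) -> forall i, 0 <= col_mx s x i 0.
  by move=> s0 x0 i; rewrite mxE; case: fintype.split => k; rewrite ?(ord1 k).
have [[x [x0 Ax]]|[p [pA py]]] := IH A' y.
  left; exists (col_mx (0 : 'cV_1) x : 'cV_(1 + m)); split.
    by apply: col_ge0; rewrite ?mxE.
  by rewrite [A]AE (mul_row_col a A') mulmx0 add0r.
have sp_ge0 (p' : 'rV[R]_n) : 0 <= (p' *m a) 0 0 ->
    (forall j, 0 <= (p' *m A') 0 j) -> forall j, 0 <= (p' *m A) 0 j.
  move=> pa pA' j; rewrite [A]AE (mul_mx_row p' a A').
  by rewrite mxE; case: fintype.split => k; rewrite ?(ord1 k).
pose c := (p *m a) 0 0.
have [c0|c0] := leP 0 c.
  by right; exists p; split => //; apply: sp_ge0.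
(* [P] projects onto the kernel of [p] along [a]. *)
pose P : 'M[R]_n := 1%:M - c^-1 *: (a *m p).
have c_neq0 : c != 0 by rewrite lt_eqF.
have Pa : P *m a = 0.
  rewrite mulmxBl mul1mx -scalemxAl -mulmxA [p *m a]mx11_scalar -/c.
  by rewrite mul_mx_scalar scalerA mulVf // scale1r subrr.
have [[x [x0 Ax]]|[p' [pA' py']]] := IH (P *m A') (P *m y); last first.
  right; exists (p' *m P); split; last by rewrite -mulmxA.
  apply: sp_ge0; first by rewrite -mulmxA Pa mulmx0 mxE.
  by move=> j; rewrite -mulmxA.
left.
(* [P] kills [y - A' *m x], which is therefore a multiple of [a]; its coefficient [s] is a quotient
   of two nonpositive numbers. *)
pose s := (p *m (y - A' *m x)) 0 0 / c.
have s0 : 0 <= s.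
  apply: mulr_le0; last by rewrite invr_le0 ltW.
  rewrite mulmxBr mulmxA mxE [X in _ + X]mxE.
  rewrite subr_le0; apply: le_trans (ltW py) _.
  by rewrite mxE; apply: sumr_ge0 => k _; apply: mulr_ge0.
exists (col_mx (s%:M : 'cV_1) x : 'cV_(1 + m)); split.
  by apply: col_ge0; rewrite ?mxE.
rewrite [A]AE (mul_row_col a A').
have : P *m (y - A' *m x) = 0 by rewrite mulmxBr mulmxA Ax subrr.
rewrite mulmxBl mul1mx -scalemxAl -mulmxA [p *m (y - _)]mx11_scalar.
rewrite !mul_mx_scalar scalerA mulrC -/s => /eqP; rewrite subr_eq0 => /eqP <-.
by rewrite subrK.
Qed.

(** * Scalar calculus of positive parts and residuals *)

Section Residual.
Variables (R : realType) (r : R).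
Hypothesis r_ge2 : 2 <= r.
Implicit Types a b : R.

Let r_gt0 : 0 < r. Proof. by move: r_ge2; lra. Qed.
Let r1_ge1 : 1 <= r - 1. Proof. by move: r_ge2; lra. Qed.
Let r_neq0 : r != 0. Proof. exact: lt0r_neq0. Qed.
Let r1_neq0 : r - 1 != 0. Proof. by apply: lt0r_neq0; move: r1_ge1; lra. Qed.

Lemma pospart_ge0 a : 0 <= pospart a.
Proof. by rewrite /pospart le_max lexx orbT. Qed.

Lemma ger_pospart a : a <= pospart a.
Proof. by rewrite /pospart le_max lexx. Qed.

Lemma pospart_id a : 0 <= a -> pospart a = a.
Proof. by move=> a0; rewrite /pospart max_l. Qed.

Lemma pospart_eq0 a : a <= 0 -> pospart a = 0.
Proof. by move=> a0; rewrite /pospart max_r. Qed.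

Lemma norm_negpart a : `|negpart a| = pospart (- a).
Proof.
rewrite /negpart; have [a0|a0] := leP a 0.
  by rewrite ler0_norm // pospart_id // oppr_ge0.
by rewrite normr0 pospart_eq0 // oppr_le0 ltW.
Qed.

Lemma is_derive_pospart_powR a :
  is_derive a 1 (fun s => pospart s `^ r) (r * pospart a `^ (r - 1)).
Proof.
have [a0|a0|->] := ltgtP a 0.
- rewrite pospart_eq0 ?ltW // powR0 // mulr0.
  apply: (@near_eq_is_derive _ _ _ (cst 0)).
  by near=> s; rewrite /cst pospart_eq0 ?powR0 //; apply: ltW; near: s; apply: lt_nbhsl.
- rewrite pospart_id ?ltW //.
  apply: (@near_eq_is_derive _ _ _ (fun s => s `^ r)); last exact: is_derive1_powR.
  by near=> s; rewrite pospart_id //; apply: ltW; near: s; apply: lt_nbhsr.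
(* At 0 the difference quotient is the power [r - 1] of the positive part. It is at most [z] for
   [0 < z < 1] because [r - 1 >= 1], hence tends to 0. *)
- apply/is_derive1_caratheodory; exists (fun s => pospart s `^ (r - 1)).
  have p0 : pospart 0 = 0 :> R by rewrite pospart_eq0.
  split; last by rewrite p0 powR0 // mulr0.
  + move=> z; rewrite p0 powR0 // !subr0.
    have [z0|z0] := leP 0 z; last by rewrite pospart_eq0 ?ltW // !powR0 // mul0r.
    by rewrite pospart_id // mulrC mulr_powRB1.
  + rewrite /prop_for /continuous_at p0 powR0 //.
    apply/cvgrPdist_lt => e e0; near=> z.
    rewrite sub0r normrN ger0_norm ?powR_ge0 //.
    have [z0|z0] := leP z 0; first by rewrite pospart_eq0 // powR0.
    have ze : z < Num.min e 1 by near: z; apply: lt_nbhsl; rewrite lt_min e0 ltr01.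
    move: ze; rewrite lt_min => /andP[ze z1].
    rewrite pospart_id ?ltW //; apply: le_lt_trans ze.
    by apply: ge1r_powR; rewrite ?z0 ?(ltW z1).
Unshelve. all: by end_near. Qed.

Lemma continuous_pospart_powR : continuous (fun s : R => pospart s `^ r).
Proof.
move=> a; apply/differentiable_continuous/derivable1_diffP.
by apply: ex_derive; apply: is_derive_pospart_powR.
Qed.

(* With [w = M x + q], the gradient of [f_r] at [x] is [u + M^T v] for
   [u_i = residual (x_i) (w_i)] and [v_i = residual (w_i) (x_i)]. *)
Definition residual a b : R :=
  pospart a `^ (r - 1) * pospart b `^ r - pospart (- a) `^ (r - 1).

Lemma residual_pos a b : 0 < a -> 0 < b -> 0 < residual a b.
Proof.
move=> a0 b0; rewrite /residual [X in _ - X `^ _]pospart_eq0 ?oppr_le0 ?ltW //.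
by rewrite powR0 // subr0 !pospart_id ?ltW // mulr_gt0 // powR_gt0.
Qed.

Lemma residual_nonpos a b : a <= 0 \/ b <= 0 ->
  residual a b = - pospart (- a) `^ (r - 1).
Proof.
by case=> h; rewrite /residual (pospart_eq0 h) powR0 // ?mulr0 ?mul0r sub0r.
Qed.

Lemma residual_eq0_ge0 a b : residual a b = 0 -> 0 <= a.
Proof.
move=> ab0; rewrite leNgt; apply/negP => a0.
move: ab0; rewrite residual_nonpos; last by left; apply: ltW.
move/eqP; rewrite oppr_eq0; apply/negP/lt0r_neq0.
by apply: powR_gt0; rewrite pospart_id ?oppr_gt0 // oppr_ge0 ltW.
Qed.

(** Either both arguments are positive and so are both residuals, or both residuals are opposites of
    powers. *)
Lemma residual_mul_ge0 a b : 0 <= residual a b * residual b a.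
Proof.
have [a0|a0] := leP a 0.
  rewrite !residual_nonpos; try by [left|right].
  by rewrite mulrNN mulr_ge0 // powR_ge0.
have [b0|b0] := leP b 0.
  rewrite !residual_nonpos; try by [left|right].
  by rewrite mulrNN mulr_ge0 // powR_ge0.
by rewrite ltW // mulr_gt0 // residual_pos.
Qed.

Lemma residual_mul_eq0 a b : residual a b * residual b a = 0 -> a <= 0 \/ b <= 0.
Proof.
move=> ab0; have [a0|a0] := leP a 0; first by left.
have [b0|b0] := leP b 0; first by right.
by have := mulr_gt0 (residual_pos a0 b0) (residual_pos b0 a0); rewrite ab0 ltxx.
Qed.

Lemma residual_eq0 a b : 0 <= a -> 0 <= b -> a * b = 0 -> residual a b = 0.
Proof.
move=> a0 b0 ab0; rewrite residual_nonpos.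
  by rewrite pospart_eq0 ?oppr_le0 // powR0 // oppr0.
by move/eqP: ab0; rewrite mulf_eq0 => /orP[] /eqP ->; [left|right].
Qed.

(** Turns the pairings of the residuals with [x] and [w] into sums of [r]-th powers of negative
    parts. *)
Lemma mul_pospart_opp a : a * pospart (- a) `^ (r - 1) = - pospart (- a) `^ r.
Proof.
have [a0|a0] := leP a 0.
  rewrite pospart_id ?oppr_ge0 // -(@mulr_powRB1 _ (- a) r) ?oppr_ge0 //.
  by rewrite mulNr opprK.
by rewrite pospart_eq0 ?oppr_le0 ?ltW // !powR0 // mulr0 oppr0.
Qed.

End Residual.

(** * Continuity of real-valued functions *)

Section ContinuousRealFunctions.
Variables (R : realType) (T : topologicalType).
Implicit Types f g : T -> R.

Lemma continuous_fadd f g :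
  continuous f -> continuous g -> continuous (fun x => f x + g x).
Proof. by move=> cf cg x; apply: cvgD; [exact: cf|exact: cg]. Qed.

Lemma continuous_fmul f g :
  continuous f -> continuous g -> continuous (fun x => f x * g x).
Proof. by move=> cf cg x; apply: cvgM; [exact: cf|exact: cg]. Qed.

Lemma continuous_fopp f : continuous f -> continuous (fun x => - f x).
Proof. by move=> cf x; apply: cvgN; exact: cf. Qed.

Lemma continuous_fcomp (p : R -> R) f :
  continuous p -> continuous f -> continuous (fun x => p (f x)).
Proof. by move=> cp cf x; apply: continuous_comp; [exact: cf|exact: cp]. Qed.

Lemma continuous_fsum n (F : 'I_n -> T -> R) :
  (forall i, continuous (F i)) -> continuous (fun x => \sum_(i < n) F i x).
Proof. by move=> cF; apply: continuous_big => //; exact: add_continuous. Qed.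

End ContinuousRealFunctions.

Lemma continuous_mulmx_coord (R : realType) n (M : 'M[R]_n) i :
  continuous (fun x : 'cV[R]_n => (M *m x) i 0).
Proof.
have -> : (fun x : 'cV[R]_n => (M *m x) i 0) = (fun x => \sum_j M i j * x j 0).
  by apply/funext => x; rewrite mxE.
apply: continuous_fsum => j; apply: continuous_fmul; first exact: cst_continuous.
exact: coord_continuous.
Qed.

(** * Gradient and continuity of [f_r] *)

Section Gradient.
Variables (R : realType) (n : nat) (M : 'M[R]_n) (q : 'cV[R]_n) (r : R).
Hypothesis r_ge2 : 2 <= r.

Lemma f_rE x : f_r M q r x = r^-1 * \sum_(i < n)
  (pospart (x i 0) `^ r * pospart ((M *m x + q) i 0) `^ r +
   pospart (- x i 0) `^ r + pospart (- (M *m x + q) i 0) `^ r).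
Proof.
by rewrite /f_r !big_split /=; congr (_ * (_ + _ + _));
  apply: eq_bigr => i _; rewrite norm_negpart.
Qed.

Lemma f_r_ge0 x : 0 <= f_r M q r x.
Proof.
rewrite f_rE mulr_ge0 ?invr_ge0 //; first by move: r_ge2; lra.
by apply: sumr_ge0 => i _; rewrite !addr_ge0 ?mulr_ge0 ?powR_ge0.
Qed.

Definition resx (x : 'cV[R]_n) : 'cV[R]_n := \col_i residual r (x i 0) ((M *m x + q) i 0).
Definition resw (x : 'cV[R]_n) : 'cV[R]_n := \col_i residual r ((M *m x + q) i 0) (x i 0).

Lemma is_derive_affine (a b t : R) : is_derive t 1 (fun h => h * a + b) a.
Proof.
have -> : (fun h : R => h * a + b) = (id * cst a) + cst b by [].
apply: is_derive_eq; rewrite /= scaler0 add0r.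
by rewrite addr0 [LHS]mulr1.
Qed.

(** Along a line the coordinates of [x] and [w] are affine in [h], so one-variable rules apply.
    Arbitrary [t] provides the derivability on an interval used at a minimizer. *)
Lemma is_derive_f_r_line (x v : 'cV[R]_n) (t : R) :
  is_derive t 1 (fun h : R => f_r M q r (h *: v + x))
    (\sum_i (resx (t *: v + x) i 0 * v i 0 +
             resw (t *: v + x) i 0 * (M *m v) i 0)).
Proof.
have xE h i : (h *: v + x) i 0 = h * v i 0 + x i 0 by rewrite !mxE.
have wE h i : (M *m (h *: v + x) + q) i 0 = h * (M *m v) i 0 + (M *m x + q) i 0.
  rewrite mulmxDr -scalemxAr.
  by rewrite -addrA [LHS]mxE [X in X + _ = _]mxE.
pose p (s : R) := pospart s `^ r.
pose X i := fun h : R => h * v i 0 + x i 0.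
pose W i := fun h : R => h * (M *m v) i 0 + (M *m x + q) i 0.
have -> : (fun h : R => f_r M q r (h *: v + x)) =
   r^-1 *: (\sum_i ((p \o X i) * (p \o W i) + (p \o (- X i)) + (p \o (- W i)))).
  apply/funext => h; rewrite f_rE fctE; congr (_ * _).
  by rewrite fct_sumE; apply: eq_bigr => i _; rewrite xE wE.
have dX i : is_derive t 1 (X i) (v i 0) by apply: is_derive_affine.
have dW i : is_derive t 1 (W i) ((M *m v) i 0) by apply: is_derive_affine.
have dp (s : R) : is_derive s 1 p (r * pospart s `^ (r - 1)).
  exact: is_derive_pospart_powR.
apply: is_derive_eq.
rewrite scaler_sumr; apply: eq_bigr => i _.
rewrite [resx _ i 0]mxE [resw _ i 0]mxE.
have -> : (t *: v + x) i 0 = X i t by rewrite xE.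
have -> : (M *m (t *: v + x) + q) i 0 = W i t by rewrite wE.
rewrite /residual /p /= !fctE /GRing.scale /=.
have r0 : r != 0 by apply: lt0r_neq0; move: r_ge2; lra.
(* The factor [r] common to all derivatives cancels [r^-1]. *)
rewrite -[in RHS](mulKf r0 (_ + _)); congr (_ * _).
ring.
Qed.

Lemma is_derive_f_r (x v : 'cV[R]_n) :
  is_derive x v (f_r M q r)
    (\sum_i (resx x i 0 * v i 0 + resw x i 0 * (M *m v) i 0)).
Proof.
have [d1 d2] := is_derive_f_r_line x v 0.
rewrite scale0r add0r in d2.
split; first exact/derivable1P.
(* The directional derivative at [x] and the derivative of the line function at 0 are limits of the
   same quotient. *)
rewrite -d2 /derive; apply: (congr1 (fun g : R -> R => lim (g @ 0^'))).
apply/funext => h /=.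
by rewrite addr0 scale0r add0r [_%:A]mulr1.
Qed.

Lemma grad_f_r x : grad (f_r M q r) x = resx x + M^T *m resw x.
Proof.
apply/matrixP => i j; rewrite (ord1 j) [LHS]mxE.
have [_ ->] := is_derive_f_r x (delta_mx i 0).
rewrite big_split /= mxE; congr (_ + _).
  rewrite (bigD1 i) //= [X in _ * X]mxE !eqxx mulr1 big1 ?addr0 // => k /negbTE ki.
  by rewrite [X in _ * X]mxE ki mulr0.
rewrite [RHS]mxE; apply: eq_bigr => k _; rewrite [in RHS]mxE mulrC; congr (_ * _).
rewrite mxE (bigD1 i) //= [X in _ * X]mxE !eqxx mulr1 big1 ?addr0 // => l /negbTE li.
by rewrite [X in _ * X]mxE li mulr0.
Qed.

Lemma Gf_res x : Gf M q r x <-> resx x + M^T *m resw x = 0.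
Proof. by rewrite /Gf grad_f_r. Qed.

Lemma continuous_f_r : continuous (f_r M q r).
Proof.
have cx i : continuous (fun x : 'cV[R]_n => x i 0) by exact: coord_continuous.
have cw i : continuous (fun x : 'cV[R]_n => (M *m x + q) i 0).
  have -> : (fun x : 'cV[R]_n => (M *m x + q) i 0) =
      (fun x => (M *m x) i 0 + q i 0) by apply/funext => x; rewrite mxE.
  apply: continuous_fadd; last exact: cst_continuous.
  exact: continuous_mulmx_coord.
have cp (g : 'cV[R]_n -> R) : continuous g -> continuous (fun x => pospart (g x) `^ r).
  move=> cg; apply: (@continuous_fcomp _ _ (fun s => pospart s `^ r) g) => //.
  exact: continuous_pospart_powR.
have -> : f_r M q r = (fun x => r^-1 * \sum_(i < n)
    (pospart (x i 0) `^ r * pospart ((M *m x + q) i 0) `^ r +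
     pospart (- x i 0) `^ r + pospart (- (M *m x + q) i 0) `^ r)).
  by apply/funext => x; exact: f_rE.
apply: continuous_fmul; first exact: cst_continuous.
apply: continuous_fsum => i.
apply: continuous_fadd; first apply: continuous_fadd.
- by apply: continuous_fmul; apply: cp.
- by apply: cp; apply: continuous_fopp.
- by apply: cp; apply: continuous_fopp.
Qed.

Lemma f_r_min_Gf x : (forall y, f_r M q r x <= f_r M q r y) -> Gf M q r x.
Proof.
move=> xmin; apply/matrixP => i j; rewrite (ord1 j) [LHS]mxE [RHS]mxE.
have [_ ->] := is_derive_f_r x (delta_mx i 0).
have d t := is_derive_f_r_line x (delta_mx i 0) t.
(* Fermat's rule along a coordinate line; any open interval around 0 would do. *)
have [] := @derive1_at_min _ (fun h : R => f_r M q r (h *: delta_mx i 0 + x)) (-1) 1 0.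
- by lra.
- by move=> t _; apply: ex_derive.
- by rewrite in_itv /=; apply/andP; split; lra.
- by move=> t _; rewrite scale0r add0r.
- by move=> _; have [_ ->] := d 0; rewrite scale0r add0r.
Qed.

End Gradient.

(** * Solutions and stationary points *)

Section Complementarity.
Variables (R : realType) (n : nat) (M : 'M[R]_n) (q : 'cV[R]_n).

Lemma sol_compl x : sol M q x -> forall i, x i 0 * (M *m x + q) i 0 = 0.
Proof.
move=> [x0 [w0 xw]] i.
have /psumr_eq0P : \sum_i x i 0 * (M *m x + q) i 0 = 0.
  by rewrite -[RHS]xw [RHS]mxE; apply: eq_bigr => k _; rewrite [x^T _ _]mxE.
by apply => // k _; apply: mulr_ge0.
Qed.

Lemma compl_sol (x : 'cV[R]_n) : (forall i, 0 <= x i 0) -> (forall i, 0 <= (M *m x + q) i 0) ->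
  (forall i, x i 0 * (M *m x + q) i 0 = 0) -> sol M q x.
Proof.
move=> x0 w0 xw; split => //; split => //.
by rewrite mxE big1 // => k _; rewrite [x^T _ _]mxE.
Qed.

(** With [w = M x + q] and [v = M y + q], complementarity reduces [(x - y)_i (M (x - y))_i] to
    [- (x_i v_i + y_i w_i)], so [x - y] is sign-reversed. *)
Lemma no_sign_reversal_sol_unique x y :
  no_sign_reversal M -> sol M q x -> sol M q y -> x = y.
Proof.
move=> nM sx sy; apply/eqP; rewrite -subr_eq0; apply/eqP; apply: nM => i.
have xw := sol_compl sx i; have yw := sol_compl sy i.
have [x0 [xw0 _]] := sx; have [y0 [yw0 _]] := sy.
have -> : M *m (x - y) = (M *m x + q) - (M *m y + q).
  by rewrite mulmxBr opprD addrACA subrr addr0.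
set w := M *m x + q in xw xw0 *; set v := M *m y + q in yw yw0 *.
have -> : (x - y) i 0 = x i 0 - y i 0 by rewrite !mxE.
have -> : (w - v) i 0 = w i 0 - v i 0 by rewrite !mxE.
have h1 : 0 <= x i 0 * v i 0 by apply: mulr_ge0.
have h2 : 0 <= y i 0 * w i 0 by apply: mulr_ge0.
have -> : (x i 0 - y i 0) * (w i 0 - v i 0) =
  x i 0 * w i 0 + y i 0 * v i 0 - (x i 0 * v i 0 + y i 0 * w i 0) by ring.
by rewrite xw yw; lra.
Qed.

Variable r : R.
Hypothesis r_ge2 : 2 <= r.

Lemma sol_sub_Gf : sol M q `<=` Gf M q r.
Proof.
move=> x sx; have xw := sol_compl sx; have [x0 [w0 _]] := sx.
apply/Gf_res => //.
have -> : resx M q r x = 0.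
  by apply/matrixP => i j; rewrite [LHS]mxE [RHS]mxE residual_eq0.
have -> : resw M q r x = 0.
  by apply/matrixP => i j; rewrite [LHS]mxE [RHS]mxE residual_eq0 // mulrC.
by rewrite mulmx0 addr0.
Qed.

(** A vanishing residual excludes a negative first argument, and two positive arguments would make
    both residuals positive. *)
Lemma res_eq0_sol x : resx M q r x = 0 -> resw M q r x = 0 -> sol M q x.
Proof.
move=> u0 v0.
have u0i i : residual r (x i 0) ((M *m x + q) i 0) = 0.
  by have := congr1 (fun z : 'cV_n => z i 0) u0; rewrite !mxE.
have v0i i : residual r ((M *m x + q) i 0) (x i 0) = 0.
  by have := congr1 (fun z : 'cV_n => z i 0) v0; rewrite !mxE.
have x0 i : 0 <= x i 0 by apply: (residual_eq0_ge0 r_ge2 (u0i i)).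
have w0 i : 0 <= (M *m x + q) i 0 by apply: (residual_eq0_ge0 r_ge2 (v0i i)).
apply: compl_sol => // i.
have uv0 : residual r (x i 0) ((M *m x + q) i 0) *
    residual r ((M *m x + q) i 0) (x i 0) = 0 by rewrite u0i mul0r.
have [xi|wi] := residual_mul_eq0 r_ge2 uv0.
  have -> : x i 0 = 0 by apply/le_anti; rewrite xi x0.
  by rewrite mul0r.
have -> : (M *m x + q) i 0 = 0 by apply/le_anti; rewrite wi w0.
by rewrite mulr0.
Qed.

Lemma no_sign_reversal_Gf_sol : no_sign_reversal M^T -> Gf M q r `<=` sol M q.
Proof.
move=> nM x /(Gf_res M q r_ge2) g.
have v0 : resw M q r x = 0.
  apply: nM => i.
  have -> : (M^T *m resw M q r x) i 0 = - resx M q r x i 0.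
    have := congr1 (fun z : 'cV_n => z i 0) g; rewrite [LHS]mxE [RHS]mxE.
    by move/eqP; rewrite addrC addr_eq0 => /eqP.
  rewrite mulrN oppr_le0 mulrC [resx M q r x i 0]mxE.
  by rewrite [resw M q r x i 0]mxE residual_mul_ge0.
by apply: res_eq0_sol => //; move: g; rewrite v0 mulmx0 addr0.
Qed.

Lemma dotmx_adj (x y : 'cV[R]_n) :
  \sum_i (M^T *m y) i 0 * x i 0 = \sum_i y i 0 * (M *m x) i 0.
Proof.
under eq_bigr do rewrite mxE big_distrl /=.
rewrite exchange_big /=; apply: eq_bigr => j _.
rewrite mxE big_distrr /=; apply: eq_bigr => i _.
by rewrite mxE; ring.
Qed.

Lemma psd_sum_ge0 (x : 'cV[R]_n) : psd M -> 0 <= \sum_i x i 0 * (M *m x) i 0.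
Proof.
move=> /(_ x); rewrite -mulmxA mxE => h; apply: le_trans h _.
by rewrite le_eqVlt; apply/orP; left; apply/eqP; apply: eq_bigr => i _; rewrite mxE.
Qed.

Lemma psd_Gf_sol : psd M -> fea M q !=set0 -> Gf M q r `<=` sol M q.
Proof.
move=> psdM [z [z0 wz0]] x /(Gf_res M q r_ge2) g.
set u := resx M q r x in g *; set v := resw M q r x in g *.
have gE (y : 'cV[R]_n) : \sum_i u i 0 * y i 0 + \sum_i v i 0 * (M *m y) i 0 = 0.
  rewrite -dotmx_adj -big_split /= big1 // => i _; rewrite -mulrDl.
  have -> : u i 0 + (M^T *m v) i 0 = (u + M^T *m v) i 0 by rewrite [RHS]mxE.
  by rewrite g mxE mul0r.
have uv i : u i 0 * v i 0 = residual r (x i 0) ((M *m x + q) i 0) *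
    residual r ((M *m x + q) i 0) (x i 0) by rewrite [u i 0]mxE [v i 0]mxE.
have uv_ge0 i : 0 <= u i 0 * v i 0 by rewrite uv residual_mul_ge0.
(* Pairing stationarity with [v] itself gives [sum u_i v_i + v^T M v = 0], where no term is
   negative. *)
have uv0 i : u i 0 * v i 0 = 0.
  have /psumr_eq0P : \sum_i u i 0 * v i 0 = 0.
    apply/le_anti/andP; split; last exact: sumr_ge0.
    by have := gE v; have := psd_sum_ge0 v psdM; lra.
  by apply.
have xw i : x i 0 <= 0 \/ (M *m x + q) i 0 <= 0.
  by apply: (residual_mul_eq0 r_ge2); rewrite -uv.
have uE i : u i 0 = - pospart (- x i 0) `^ (r - 1).
  by rewrite mxE residual_nonpos.
have vE i : v i 0 = - pospart (- (M *m x + q) i 0) `^ (r - 1).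
  by rewrite mxE residual_nonpos //; case: (xw i); [right|left].
have u_le0 i : u i 0 <= 0 by rewrite uE oppr_le0 powR_ge0.
have v_le0 i : v i 0 <= 0 by rewrite vE oppr_le0 powR_ge0.
have split_w y : \sum_i v i 0 * (M *m y + q) i 0 =
    \sum_i v i 0 * (M *m y) i 0 + \sum_i v i 0 * q i 0.
  by rewrite -big_split /=; apply: eq_bigr => i _; rewrite [X in _ * X = _]mxE mulrDr.
have ux i : u i 0 * x i 0 = pospart (- x i 0) `^ r.
  by rewrite uE mulNr mulrC mul_pospart_opp // opprK.
have vw i : v i 0 * (M *m x + q) i 0 = pospart (- (M *m x + q) i 0) `^ r.
  by rewrite vE mulNr mulrC mul_pospart_opp // opprK.
have zu : \sum_i u i 0 * z i 0 <= 0.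
  by apply: sumr_le0 => i _; apply: mulr_le0_ge0.
have zv : \sum_i v i 0 * (M *m z + q) i 0 <= 0.
  by apply: sumr_le0 => i _; apply: mulr_le0_ge0.
have xu : 0 <= \sum_i u i 0 * x i 0.
  by apply: sumr_ge0 => i _; rewrite ux powR_ge0.
have xv : 0 <= \sum_i v i 0 * (M *m x + q) i 0.
  by apply: sumr_ge0 => i _; rewrite vw powR_ge0.
(* Both pairings with stationarity give [u.z + v.(M z + q) = v.q = u.x + v.(M x + q)]. The left side
   is at most 0 and the right side is a sum of nonnegative terms, so everything vanishes. *)
have gz := gE z; have gx := gE x.
rewrite split_w in zv; rewrite split_w in xv.
have xu0 : \sum_i u i 0 * x i 0 = 0 by lra.
have xv0 : \sum_i v i 0 * (M *m x + q) i 0 = 0 by rewrite split_w; lra.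
have pow0 (a : R) : pospart (- a) `^ r = 0 -> pospart (- a) `^ (r - 1) = 0.
  by move/powR_eq0_eq0 => ->; rewrite powR0 //; apply: lt0r_neq0; move: r_ge2; lra.
apply: res_eq0_sol; apply/matrixP => i j; rewrite (ord1 j) [RHS]mxE.
  rewrite -/u uE pow0 ?oppr0 // -ux.
  by move/psumr_eq0P: xu0; apply => // k _; rewrite ux powR_ge0.
rewrite -/v vE pow0 ?oppr0 // -vw.
by move/psumr_eq0P: xv0; apply => // k _; rewrite vw powR_ge0.
Qed.

End Complementarity.

(** * Existence through a minimizer of [f_r] *)

Section ExistenceNoSignReversal.
Variables (R : realType) (n : nat) (M : 'M[R]_n) (q : 'cV[R]_n).

Lemma continuous_pospart : continuous (@pospart R).
Proof.
have -> : @pospart R = (fun s => (s + `|s|) * 2^-1).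
  by apply/funext => s; rewrite /pospart maxr_absE addr0 subr0.
apply: continuous_fmul; last exact: cst_continuous.
by apply: continuous_fadd => [s|]; [exact: cvg_id|exact: norm_continuous].
Qed.

Lemma continuous_trmx m k : continuous (fun v : 'M[R]_(m, k) => v^T).
Proof.
move=> v s /= /nbhs_ballP[e e0 es]; apply/nbhs_ballP; exists e => //= N [_ vN].
by apply: es; split => // i j; rewrite !mxE; exact: vN.
Qed.

Lemma norm_coord_le (x : 'cV[R]_n) i : `|x i 0| <= `|x|.
Proof.
rewrite [leRHS]/Num.norm /= mx_normrE; apply/bigmax_geP; right => /=.
by exists (i, 0).
Qed.

(** Heine-Borel for row vectors, carried over by transposition. *)
Lemma compact_bounded_closed_cV (A : set 'cV[R]_n) (B : R) :
  (forall x, A x -> `|x| <= B) -> closed A -> compact A.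
Proof.
move=> AB clA.
have -> : A = (fun v : 'rV[R]_n => v^T) @` [set v : 'rV[R]_n | A v^T].
  apply/seteqP; split => [x Ax|_ [v Av <-] //].
  by exists x^T; rewrite /= trmxK.
apply: continuous_compact; first by apply: continuous_subspaceT; exact: continuous_trmx.
apply: bounded_closed_compact.
  exists B; split; first exact: num_real.
  move=> y By v Av; apply: le_trans (ltW By).
  rewrite [leLHS]/Num.norm /= mx_normrE; apply: bigmax_le => [|[i j] _].
    by apply: le_trans (AB _ Av); exact: normr_ge0.
  apply: le_trans (AB _ Av); rewrite (ord1 i).
  have -> : v 0 j = v^T j 0 by rewrite mxE.
  exact: norm_coord_le.
exact: (continuous_closedP _).1 (@continuous_trmx 1 n) _ clA.
Qed.

(** A minimizer over the compact sublevel set at [f 0] is global, since [f] exceeds [f 0] outside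
    it. *)
Lemma bounded_sublevel_min (f : 'cV[R]_n -> R) : continuous f ->
  (exists B : R, forall x, f x <= f 0 -> `|x| <= B) ->
  exists c, forall y, f c <= f y.
Proof.
move=> cf [B BP].
pose A := [set x : 'cV[R]_n | f x <= f 0].
have cA : compact A.
  apply: (@compact_bounded_closed_cV _ B) => //.
  have -> : A = f @^-1` [set y | y <= f 0] by [].
  by apply: (continuous_closedP _).1 => //; exact: closed_le.
have [c cA' cmin] : exists2 c, c \in A & forall t, t \in A -> f c <= f t.
  apply: compact_EVT_min => //; first by exists 0; rewrite /A /=.
  exact: continuous_subspaceT.
rewrite inE in cA'; exists c => y.
have [yA|yA] := leP (f y) (f 0); first by apply: cmin; rewrite inE.
exact: le_trans cA' (ltW yA).
Qed.

(* The quadratic growth comes from compactness of the unit sphere and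
   homogeneity. *)
Lemma no_sign_reversal_growth : no_sign_reversal M ->
  exists2 c : R, 0 < c & forall x : 'cV[R]_n,
    c * `|x| ^+ 2 <= \sum_i pospart (x i 0 * (M *m x) i 0).
Proof.
move=> nM.
pose g (x : 'cV[R]_n) := \sum_i pospart (x i 0 * (M *m x) i 0).
have g_ge0 x : 0 <= g x by apply: sumr_ge0 => i _; apply: pospart_ge0.
have gZ (k : R) x : g (k *: x) = k ^+ 2 * g x.
  rewrite /g big_distrr /=; apply: eq_bigr => i _.
  rewrite -scalemxAr.
  have -> : (k *: x) i 0 = k * x i 0 by rewrite mxE.
  have -> : (k *: (M *m x)) i 0 = k * (M *m x) i 0 by rewrite mxE.
  rewrite mulrACA -expr2 /pospart.
  by rewrite maxr_pMr ?sqr_ge0 // mulr0.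
have g_gt0 x : x != 0 -> 0 < g x.
  move=> x0; rewrite lt_def g_ge0 andbT; apply: contraNneq x0.
  move=> /psumr_eq0P gx0; apply/eqP/nM => i.
  by rewrite -(gx0 _ i) ?ger_pospart // => k _; apply: pospart_ge0.
pose A := [set x : 'cV[R]_n | `|x| = 1].
have cA : compact A.
  apply: (@compact_bounded_closed_cV _ 1); first by move=> x ->.
  have -> : A = (fun x : 'cV[R]_n => `|x|) @^-1` [set 1] by [].
  apply: (continuous_closedP _).1; first exact: norm_continuous.
  exact: closed_eq.
have cg : continuous g.
  apply: continuous_fsum => i.
  apply: (@continuous_fcomp _ _ (@pospart R)); first exact: continuous_pospart.
  by apply: continuous_fmul; [exact: coord_continuous|exact: continuous_mulmx_coord].
have normalize (x : 'cV[R]_n) : x != 0 -> A (`|x|^-1 *: x).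
  by move=> x0; rewrite /A /= normrZ normfV normr_id mulVf // normr_eq0.
(* If the sphere is empty ([n = 0]), every vector is 0 and any constant works. *)
have [[y Ay]|nA] := pselect (A !=set0); last first.
  exists 1 => // x; have [->|x0] := eqVneq x 0.
    by rewrite normr0 expr0n mulr0; exact: g_ge0.
  by case: nA; exists (`|x|^-1 *: x); apply: normalize.
have [c cA' cmin] : exists2 c, c \in A & forall t, t \in A -> g c <= g t.
  apply: compact_EVT_min => //; first by exists y.
  exact: continuous_subspaceT.
rewrite inE in cA'.
exists (g c).
  by apply: g_gt0; rewrite -normr_eq0 cA' oner_eq0.
move=> x; have [->|x0] := eqVneq x 0.
  by rewrite normr0 expr0n mulr0; exact: g_ge0.
have nx : `|x| != 0 by rewrite normr_eq0.
have -> : \sum_i pospart (x i 0 * (M *m x) i 0) = `|x| ^+ 2 * g (`|x|^-1 *: x).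
  by rewrite -gZ scalerA mulfV // scale1r.
rewrite mulrC ler_wpM2l ?sqr_ge0 //; apply: cmin.
by rewrite inE; apply: normalize.
Qed.

Variable r : R.
Hypothesis r_ge2 : 2 <= r.

Lemma powR_le_bound (t G : R) : 0 <= t -> 0 <= G -> t `^ r <= G -> t <= 1 + G.
Proof.
move=> t0 G0 tG; have [t1|t1] := leP t 1; first by lra.
suff : t <= t `^ r by lra.
by apply: le1r_powR; [exact: ltW|move: r_ge2; lra].
Qed.

(** On a sublevel set each [x_i w_i] is bounded above, so [x_i (M x)_i] is at most affine in [|x|],
    against the quadratic growth just proved. *)
Lemma f_r_sublevel_bounded (F : R) : no_sign_reversal M ->
  exists B : R, forall x, f_r M q r x <= F -> `|x| <= B.
Proof.
move=> nM; have [c c0 cP] := no_sign_reversal_growth nM.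
have r0 : 0 < r by move: r_ge2; lra.
(* [G] bounds every summand of [r * f_r]; [k] then bounds the products of positive parts and both
   negative parts. *)
pose G := r * F; pose k := 1 + G.
pose a := n%:R * (k + k ^+ 2); pose b := n%:R * `|q|.
(* For [|x| > 1], [c |x|^2 <= a + b |x| <= (a + b) |x|]; the summand 1 covers [|x| <= 1]. *)
exists (1 + (a + b) / c) => x fx.
have F0 : 0 <= F by apply: le_trans fx; exact: f_r_ge0.
have G0 : 0 <= G by apply: mulr_ge0; [exact: ltW|].
have k0 : 0 <= k by rewrite /k; lra.
set w := M *m x + q.
have term i : pospart (x i 0) `^ r * pospart (w i 0) `^ r +
     pospart (- x i 0) `^ r + pospart (- w i 0) `^ r <= G.
  have : r * f_r M q r x <= G by rewrite ler_pM2l.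
  rewrite f_rE mulrA mulfV ?lt0r_neq0 // mul1r; apply: le_trans.
  rewrite (bigD1 i) //= lerDl; apply: sumr_ge0 => j _.
  by rewrite !addr_ge0 ?mulr_ge0 ?powR_ge0.
have p1 i : pospart (x i 0) * pospart (w i 0) <= k.
  apply: powR_le_bound => //; first by apply: mulr_ge0; exact: pospart_ge0.
  rewrite powRM ?pospart_ge0 //; apply: le_trans (term i).
  by rewrite -addrA lerDl addr_ge0 ?powR_ge0.
have p2 i : pospart (- x i 0) <= k.
  apply: powR_le_bound => //; first exact: pospart_ge0.
  apply: le_trans (term i).
  by rewrite addrAC lerDr addr_ge0 ?mulr_ge0 ?powR_ge0.
have p3 i : pospart (- w i 0) <= k.
  apply: powR_le_bound => //; first exact: pospart_ge0.
  apply: le_trans (term i).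
  by rewrite lerDr addr_ge0 ?mulr_ge0 ?powR_ge0.
have xw i : x i 0 * w i 0 <= k + k ^+ 2.
  have [x0|x0] := leP 0 (x i 0); have [w0|w0] := leP 0 (w i 0).
  - by have := p1 i; rewrite !pospart_id // => h; apply: le_trans h _; rewrite lerDl sqr_ge0.
  - apply: (@le_trans _ _ 0); first by apply: mulr_ge0_le0 => //; exact: ltW.
    by rewrite addr_ge0 // sqr_ge0.
  - apply: (@le_trans _ _ 0); first by apply: mulr_le0_ge0 => //; exact: ltW.
    by rewrite addr_ge0 // sqr_ge0.
  - have Nx0 : 0 <= - x i 0 by rewrite oppr_ge0 ltW.
    have Nw0 : 0 <= - w i 0 by rewrite oppr_ge0 ltW.
    have := p2 i; have := p3 i; rewrite !pospart_id // => hw hx.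
    apply: (@le_trans _ _ (k ^+ 2)); last by rewrite lerDr.
    by rewrite -mulrNN expr2; apply: ler_pM.
have xMx i : pospart (x i 0 * (M *m x) i 0) <= k + k ^+ 2 + `|x| * `|q|.
  rewrite /pospart ge_max; apply/andP; split; last first.
    by apply: addr_ge0; [apply: addr_ge0 => //; exact: sqr_ge0|exact: mulr_ge0].
  have -> : (M *m x) i 0 = w i 0 - q i 0 by rewrite [w i 0]mxE addrK.
  rewrite mulrBr; apply: lerD => //.
  apply: le_trans (ler_norm _) _; rewrite normrN normrM.
  by apply: ler_pM => //; exact: norm_coord_le.
have key : c * `|x| ^+ 2 <= a + b * `|x|.
  apply: le_trans (cP x) _.
  apply: le_trans (ler_sum _ (fun i _ => xMx i)) _.
  rewrite sumr_const card_ord -mulr_natl /a /b mulrDr lerD2l.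
  by rewrite -mulrA [`|x| * _]mulrC.
have a0 : 0 <= a by rewrite mulr_ge0 // addr_ge0 // sqr_ge0.
have b0 : 0 <= b by rewrite mulr_ge0.
have ab0 : 0 <= (a + b) / c by rewrite divr_ge0 ?addr_ge0 // ltW.
have [x1|x1] := leP `|x| 1; first by lra.
suff : `|x| <= (a + b) / c by lra.
rewrite ler_pdivlMr // -(ler_pM2r (lt_trans ltr01 x1)).
have : a <= a * `|x| by rewrite ler_peMr // ltW.
by move: key; rewrite expr2; lra.
Qed.

Lemma no_sign_reversal_sol_ex :
  no_sign_reversal M -> no_sign_reversal M^T -> sol M q !=set0.
Proof.
move=> nM nMT.
have [c cmin] : exists c, forall y, f_r M q r c <= f_r M q r y.
  apply: bounded_sublevel_min; first exact: continuous_f_r.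
  exact: f_r_sublevel_bounded.
have cG : Gf M q r c by exact: f_r_min_Gf.
by exists c; exact: (no_sign_reversal_Gf_sol r_ge2 nMT cG).
Qed.

End ExistenceNoSignReversal.

(** * Positive semidefinite case by regularization *)

(** Summed over [i], the reversed products equal [x^T M x + e * sum x_i^2]. *)
Lemma psd_addM_no_sign_reversal (R : realType) n (M : 'M[R]_n) (e : R) : psd M -> 0 < e ->
  no_sign_reversal (M + e%:M).
Proof.
move=> psdM e0 x xMx.
have h : \sum_i x i 0 * ((M + e%:M) *m x) i 0 <= 0 by apply: sumr_le0.
have hE : \sum_i x i 0 * ((M + e%:M) *m x) i 0 =
    \sum_i x i 0 * (M *m x) i 0 + e * \sum_i x i 0 ^+ 2.
  rewrite big_distrr -big_split /=; apply: eq_bigr => i _.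
  rewrite mulmxDl mul_scalar_mx [X in _ * X = _]mxE [X in _ * (_ + X) = _]mxE.
  by rewrite mulrDr expr2; congr (_ + _); rewrite mulrCA.
have x2 i : 0 <= x i 0 ^+ 2 by exact: sqr_ge0.
have x20 : \sum_i x i 0 ^+ 2 = 0.
  apply/le_anti/andP; split; last by apply: sumr_ge0.
  rewrite -(pmulr_rle0 _ e0); have := psd_sum_ge0 x psdM.
  by move: h; rewrite hE; lra.
apply/matrixP => i j; rewrite (ord1 j) [RHS]mxE; apply/eqP.
by rewrite -sqrf_eq0; apply/eqP; move/psumr_eq0P: x20; apply.
Qed.

Lemma psd_tr (R : realType) n (M : 'M[R]_n) : psd M -> psd M^T.
Proof.
move=> psdM x; have := psdM x.
have -> : x^T *m M *m x = (x^T *m M^T *m x)^T.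
  by rewrite !trmx_mul !trmxK mulmxA.
by rewrite mxE.
Qed.

Section PsdExistence.
Variables (R : realType) (n : nat) (M : 'M[R]_n) (q : 'cV[R]_n).

(* The generators of the complementary cone of [S]: [q] lies in this cone iff
   LCP(M, q) has a solution [x] supported in [S] with [M x + q] vanishing on [S]. *)
Definition compl_mx (S : {set 'I_n}) : 'M[R]_n :=
  \matrix_(i, j) (if j \in S then - M i j else (i == j)%:R).

Lemma compl_mx_mul (S : {set 'I_n}) (x w : 'cV[R]_n) :
  (forall i, i \notin S -> x i 0 = 0) -> (forall i, i \in S -> w i 0 = 0) ->
  compl_mx S *m (x + w) = w - M *m x.
Proof.
move=> xS wS; apply/matrixP => i k; rewrite (ord1 k) !mxE.
rewrite -(sumrN _ _ _) .
have -> : w i 0 = \sum_j (i == j)%:R * w j 0.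
  rewrite (bigD1 i) //= eqxx mul1r big1 ?addr0 // => j ji.
  by rewrite eq_sym (negbTE ji) mul0r.
rewrite -big_split /=; apply: eq_bigr => j _; rewrite !mxE.
have [jS|jS] := boolP (j \in S).
  by rewrite (wS _ jS) !(addr0, mulr0, add0r) mulNr.
by rewrite (xS _ jS) mulr0 oppr0 addr0 add0r.
Qed.

(** [y] splits into its parts on and off [S], whose disjoint supports give complementarity. *)
Lemma compl_cone_sol (S : {set 'I_n}) (y : 'cV[R]_n) :
  (forall i, 0 <= y i 0) -> compl_mx S *m y = q -> sol M q !=set0.
Proof.
move=> y0 yq.
pose x : 'cV[R]_n := \col_i (if i \in S then y i 0 else 0).
pose w : 'cV[R]_n := \col_i (if i \in S then 0 else y i 0).
have yE : y = x + w.
  apply/matrixP => i j; rewrite (ord1 j) !mxE.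
  by case: ifP => _; rewrite ?addr0 ?add0r.
have wE : M *m x + q = w.
  have := @compl_mx_mul S x w; rewrite -yE yq => -> => [|i iS|i iS].
  - by rewrite addrC subrK.
  - by rewrite mxE (negbTE iS).
  - by rewrite mxE iS.
exists x; apply: compl_sol; rewrite ?wE => i; rewrite !mxE; case: ifP => // _.
- by rewrite mulr0.
- by rewrite mul0r.
Qed.

(* Monotonicity between the solution of the regularized problem and a feasible
   point of the original one. *)
Lemma regularized_sol_bound (e : R) (x z : 'cV[R]_n) :
  psd M -> 0 < e -> e <= 1 -> fea M q z -> sol (M + e%:M) q x ->
  e * \sum_i x i 0 ^+ 2 <=
    2 * \sum_i z i 0 * (M *m z + q) i 0 + \sum_i z i 0 ^+ 2.
Proof.
move=> psdM e0 e1 [z0 v0] sx.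
have xw := sol_compl sx; have [x0 [w0 _]] := sx.
set v := M *m z + q in v0 *; set w := (M + e%:M) *m x + q in xw w0.
have E i : (x - z) i 0 * (M *m (x - z)) i 0 <=
   z i 0 * v i 0 + 2^-1 * z i 0 ^+ 2 - e * 2^-1 * x i 0 ^+ 2.
  have -> : (M *m (x - z)) i 0 = w i 0 - e * x i 0 - v i 0.
    rewrite /w /v mulmxBr mulmxDl mul_scalar_mx.
    set a := M *m x; set b := M *m z; rewrite !mxE; ring.
  have -> : (x - z) i 0 = x i 0 - z i 0 by rewrite !mxE.
  have h1 : 0 <= x i 0 * v i 0 by apply: mulr_ge0.
  have h2 : 0 <= z i 0 * w i 0 by apply: mulr_ge0.
  have h3 : 0 <= e * (x i 0 - z i 0) ^+ 2 by apply: mulr_ge0; [exact: ltW|exact: sqr_ge0].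
  have h4 : e * z i 0 ^+ 2 <= z i 0 ^+ 2 by apply: ler_piMl; [exact: sqr_ge0|].
  have h5 := xw i.
  (* The term in [e] is split by [2 x (x - z) = x^2 + (x - z)^2 - z^2]. *)
  have -> : (x i 0 - z i 0) * (w i 0 - e * x i 0 - v i 0) =
      z i 0 * v i 0 + x i 0 * w i 0 - x i 0 * v i 0 - z i 0 * w i 0 -
      2^-1 * (e * (x i 0 - z i 0) ^+ 2) + 2^-1 * (e * z i 0 ^+ 2) -
      e * 2^-1 * x i 0 ^+ 2 by field.
  by rewrite h5; lra.
have : 0 <= \sum_i (z i 0 * v i 0 + 2^-1 * z i 0 ^+ 2 - e * 2^-1 * x i 0 ^+ 2).
  by apply: le_trans (psd_sum_ge0 (x - z) psdM) _; apply: ler_sum => i _.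
rewrite sumrB big_split /= -!mulr_sumr; lra.
Qed.

Lemma psd_sol_ex : psd M -> fea M q !=set0 -> sol M q !=set0.
Proof.
move=> psdM [z fz].
pose K := 2 * \sum_i z i 0 * (M *m z + q) i 0 + \sum_i z i 0 ^+ 2.
have K0 : 0 <= K.
  have [z0 v0] := fz; rewrite addr_ge0 ?mulr_ge0 // sumr_ge0 // => i _.
    exact: mulr_ge0.
  exact: sqr_ge0.
apply: contrapT => nsol.
have sep (S : {set 'I_n}) : exists p : 'rV[R]_n,
    (forall j, 0 <= (p *m compl_mx S) 0 j) /\ (p *m q) 0 0 < 0.
  have [[y [y0 yq]]|//] := farkas (compl_mx S) q.
  by case: nsol; apply: compl_cone_sol yq.
have [p pP] := choice sep.
pose L S := K + \sum_i p S 0 i ^+ 2.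
pose c S := - (p S *m q) 0 0.
have L0 S : 0 <= L S by rewrite addr_ge0 // sumr_ge0 // => i _; exact: sqr_ge0.
have c0 S : 0 < c S by rewrite oppr_gt0; have [] := pP S.
(* As there are finitely many [S], summing all ratios yields one [d] with [d * L S < c S] for every
   [S]. *)
pose D := 1 + \sum_(S : {set 'I_n}) L S / c S.
have D1 : 1 <= D.
  by rewrite lerDl; apply: sumr_ge0 => S _; apply: divr_ge0 => //; exact: ltW.
have D0 : 0 < D by lra.
pose d := D^-1.
have d0 : 0 < d by rewrite invr_gt0.
have d1 : d <= 1 by rewrite invf_le1.
have dP S : d * L S < c S.
  rewrite mulrC ltr_pdivrMr // mulrC -ltr_pdivrMr // /D (bigD1 S) //=.
  have : 0 <= \sum_(T | T != S) L T / c T.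
    by apply: sumr_ge0 => T _; apply: divr_ge0 => //; exact: ltW.
  by lra.
(* The regularization parameter is [d ^+ 2], so that the squares of the entries [d * x_i] sum to at
   most [K]. *)
have e0 : 0 < d ^+ 2 by rewrite exprn_gt0.
have e1 : d ^+ 2 <= 1 by rewrite exprn_ile1 // ltW.
have [x sx] : sol (M + (d ^+ 2)%:M) q !=set0.
  (* Any exponent at least 2 serves for this auxiliary minimization. *)
  apply: (@no_sign_reversal_sol_ex _ _ _ _ 2) => //.
    exact: psd_addM_no_sign_reversal.
  rewrite linearD /= tr_scalar_mx.
  by apply: psd_addM_no_sign_reversal => //; exact: psd_tr.
have xK := regularized_sol_bound psdM e0 e1 fz sx.
have xw := sol_compl sx; have [x0 [w0 _]] := sx.
set w := (M + _) *m x + q in xw w0.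
(* [w] vanishes on the support [S] of [x], so [q + d^2 x] lies in the complementary cone of [S],
   where [p S] is nonnegative. *)
pose S := [set i | 0 < x i 0]%SET.
have [pS pq] := pP S.
have qE : q = compl_mx S *m (x + w) - d ^+ 2 *: x.
  rewrite compl_mx_mul.
  - rewrite /w mulmxDl mul_scalar_mx.
    by rewrite -addrA -opprD [X in X - _]addrC addrK.
  - move=> i; rewrite inE -leNgt => xi; apply/le_anti.
    by rewrite xi x0.
  - move=> i; rewrite inE => xi; apply/eqP.
    by have /eqP := xw i; rewrite mulf_eq0 gt_eqF.
have px : c S <= d ^+ 2 * \sum_i p S 0 i * x i 0.
  have pqE : (p S *m q) 0 0 = (p S *m compl_mx S *m (x + w)) 0 0 -
      d ^+ 2 * \sum_i p S 0 i * x i 0.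
    rewrite [in LHS]qE mulmxBr -scalemxAr mulmxA [LHS]mxE; congr (_ + _).
    by rewrite [LHS]mxE [X in - X = _]mxE [X in - (_ * X) = _]mxE.
  have : 0 <= (p S *m compl_mx S *m (x + w)) 0 0.
    rewrite mxE; apply: sumr_ge0 => i _; apply: mulr_ge0 => //.
    by rewrite mxE addr_ge0.
  by rewrite /c pqE; lra.
(* Termwise [p y <= p^2 + y^2] with [y = d x]. Together with [px] and [dP] this yields
   [c S < c S]. *)
have : d ^+ 2 * \sum_i p S 0 i * x i 0 <= d * L S.
  have -> : d ^+ 2 * \sum_i p S 0 i * x i 0 = d * (\sum_i p S 0 i * (d * x i 0)).
    by rewrite expr2 -mulrA mulr_sumr; congr (_ * _); apply: eq_bigr => i _; rewrite mulrCA.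
  rewrite ler_pM2l //.
  have -> : L S = K + \sum_i p S 0 i ^+ 2 by [].
  apply: (@le_trans _ _ (d ^+ 2 * \sum_i x i 0 ^+ 2 + \sum_i p S 0 i ^+ 2));
    last by rewrite lerD2r.
  rewrite mulr_sumr -big_split /=; apply: ler_sum => i _.
  have := sqr_ge0 (p S 0 i - d * x i 0); have := sqr_ge0 (p S 0 i).
  have := sqr_ge0 (d * x i 0); rewrite -exprMn; move: (d * x i 0) => y.
  by rewrite sqrrB -mulr_natr; lra.
by have := dP S; lra.
Qed.

End PsdExistence.

Theorem theorem3p2 (R : realType) (n : nat) (M : 'M[R]_n) (q : 'cV[R]_n) (r : R) :
  2 <= r ->
  (psd M -> fea M q !=set0 -> sol M q = Gf M q r /\ sol M q !=set0) /\
  (Pmatrix M -> exists xs : 'cV[R]_n, sol M q = [set xs] /\ Gf M q r = [set xs]).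
Proof.
move=> r2; split => [psdM feaM|PM].
  split; last exact: psd_sol_ex.
  by apply/seteqP; split; [exact: sol_sub_Gf|exact: psd_Gf_sol].
have pM := Pmatrix_pminors_pos PM.
have nM := pminors_pos_no_sign_reversal pM.
have nMT := pminors_pos_no_sign_reversal (pminors_pos_tr pM).
have [x sx] := no_sign_reversal_sol_ex q r2 nM nMT.
have solE : sol M q = [set x].
  apply/seteqP; split => [y sy|_ -> //].
  exact: no_sign_reversal_sol_unique sy sx.
exists x; split=> //; rewrite -solE; apply/seteqP.
by split; [exact: no_sign_reversal_Gf_sol|exact: sol_sub_Gf].
Qed.
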